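(* Let $I$ be an infinite set, $\mathfrak F$ the set of non-empty finite subsets of $I$, $\{X_i\}_{i\in I}$ a family of non-zero complex vector spaces and $u\in\prod_{i\in I}X_i^\times$. (a) The linear map $J^u_F:\bigotimes_{i\in F}X_i\to\bigotimes^u_{i\in I}X_i$ is injective for every $F\in\mathfrak F$. Consequently, $\Theta_X(u)\neq0$. (b) The inductive limit (in the category of vector spaces and linear maps) of the inductive system $\left(\bigotimes_{i\in F}X_i,J^u_{G;F}\right)_{F\subseteq G\in\mathfrak F}$ is $\left(\bigotimes^u_{i\in I}X_i,\{J^u_F\}_{F\in\mathfrak F}\right)$.
   Context: A map on $\prod_{i\in I}X_i$ is multilinear if it is linear in each variable separately. The tensor product of $\{X_i\}_{i\in I}$ is a pair $(\bigotimes_{i\in I}X_i,\Theta_X)$ consisting of a vector space and a multilinear map $\Theta_X:\prod_{i\in I}X_i\to\bigotimes_{i\in I}X_i$ through which every multilinear map from $\prod_{i\in I}X_i$ to a vector space factors via a unique linear map; it exists and is unique up to canonical isomorphism. Write $\otimes_{i\in I}x_i=\Theta_X(x)$ and $X_i^\times=X_i\setminus\{0\}$. For $u\in\prod_{i\in I}X_i^\times$ let $\prod^u_{i\in I}X_i=\{x\in\prod_{i\in I}X_i:x_i=u_i\text{ for all but finitely many }i\}$ and $\bigotimes^u_{i\in I}X_i=\mathrm{span}\,\Theta_X(\prod^u_{i\in I}X_i)$. For $F\in\mathfrak F$, $J^u_F:\bigotimes_{i\in F}X_i\to\bigotimes^u_{i\in I}X_i$ is the linear map with $J^u_F(\otimes_{i\in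 F}x_i)=\otimes_{j\in I}\tilde x_j$, where $\tilde x_j=x_j$ for $j\in F$ and $\tilde x_j=u_j$ for $j\in I\setminus F$. For $F\subseteq G$ in $\mathfrak F$, $J^u_{G;F}:\bigotimes_{i\in F}X_i\to\bigotimes_{i\in G}X_i$ is the linear map defined in the same way, filling in the coordinates $j\in G\setminus F$ with $u_j$. *)

(* Defs.v *)
From HB Require Import structures.
From mathcomp Require Import all_boot all_order all_algebra finmap.
From mathcomp Require Import boolp classical_sets cardinality.

Set Implicit Arguments.
Unset Strict Implicit.
Unset Printing Implicit Defensive.

Import GRing.Theory.

Local Open Scope ring_scope.

(* [dfwith x y] is the family [x] with its [i]-th coordinate replaced by
   [y : X i]. *)
Definition multilinear (K : fieldType) (I : eqType) (X : I -> lmodType K)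
    (W : lmodType K) (f : (forall i, X i) -> W) : Prop :=
  forall (x : forall i, X i) (i : I), linear (fun y : X i => f (dfwith x y)).

Record tensor_product (K : fieldType) (I : eqType) (X : I -> lmodType K) :=
  TensorProduct {
    tensor_space :> lmodType K;
    tensor : (forall i, X i) -> tensor_space;
    tensor_multilinear : multilinear tensor;
    tensor_universal : forall (W : lmodType K) (f : (forall i, X i) -> W),
      multilinear f ->
      exists2 g : {linear tensor_space -> W},
        (forall x, g (tensor x) = f x) &
        (forall h : {linear tensor_space -> W},
           (forall x, h (tensor x) = f x) -> h =1 g) }.

Arguments tensor {K I X} t x.

Section Lift.
Variables (K : fieldType) (I : eqType) (X : I -> lmodType K).
Variables (T : tensor_product X) (W : lmodType K) (f : (forall i, X i) -> W).
Hypothesis fml : multilinear f.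

Fact tensor_lift_subproof :
  exists g : {linear T -> W}, forall x, g (tensor T x) = f x.
Proof. by have [g gE _] := tensor_universal T fml; exists g. Qed.

Definition tensor_lift : {linear T -> W} := projT1 (cid tensor_lift_subproof).

Lemma tensor_liftE x : tensor_lift (tensor T x) = f x.
Proof. exact: (projT2 (cid tensor_lift_subproof)). Qed.

End Lift.

Section Span.
Variables (K : fieldType) (V : lmodType K) (A : set V).

Definition in_lin_span (v : V) : Prop :=
  exists2 s : seq (K * V),
    (forall p, p \in s -> A p.2) & v = \sum_(p <- s) p.1 *: p.2.

Definition lin_span : {pred V} := fun v => `[< in_lin_span v >].

Lemma mem_lin_span v : A v -> v \in lin_span.
Proof.
move=> Av; apply/asboolP; exists [:: (1, v)]; last by rewrite big_seq1 scale1r.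
by move=> p; rewrite inE => /eqP ->.
Qed.

Fact lin_span_submod_closed : submod_closed lin_span.
Proof.
split=> [|a v w /asboolP[s sA ->] /asboolP[t tA ->]]; apply/asboolP.
  by exists [::]; rewrite ?big_nil.
exists ([seq (a * p.1, p.2) | p <- s] ++ t) => [p|].
  by rewrite mem_cat => /orP[/mapP[q qs ->]|]; [exact: (sA q) | exact: tA].
rewrite big_cat big_map scaler_sumr; congr (_ + _).
by apply: eq_bigr => p _; rewrite scalerA.
Qed.

HB.instance Definition _ :=
  GRing.isSubmodClosed.Build K V lin_span lin_span_submod_closed.

Record lin_span_space :=
  LinSpanSpace { lin_span_val :> V; _ : lin_span_val \in lin_span }.

HB.instance Definition _ := [isSub for lin_span_val].
HB.instance Definition _ := [Choice of lin_span_space by <:].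
HB.instance Definition _ := [SubChoice_isSubLmodule of lin_span_space by <:].

End Span.

Section Fill.
Variables (K : fieldType) (I : choiceType) (X : I -> lmodType K).
Variable u : forall i, X i.

(* The family equal to [x] on [F] and to [u] elsewhere; in the first branch
   [x (FSetSub jF)] has type [X j] by conversion. *)
Definition fill (F : {fset I}) (x : forall i : F, X (val i)) (j : I) : X j :=
  match decP (@idP (j \in F)) with
  | left jF => x (FSetSub jF)
  | right _ => u j
  end.

Lemma fillT (F : {fset I}) (x : forall i : F, X (val i)) (i : F) :
  fill x (val i) = x i.
Proof.
rewrite /fill; case: i => j jF /=; case: decP => // jF'.
by rewrite (bool_irrelevance jF' jF).
Qed.

Lemma fillF (F : {fset I}) (x : forall i : F, X (val i)) (j : I) :
  j \notin F -> fill x j = u j.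
Proof. by rewrite /fill; case: decP => // jF /negP. Qed.

Lemma fill_dfwith (F : {fset I}) (x : forall i : F, X (val i)) (i : F)
    (y : X (val i)) :
  fill (dfwith x y) = dfwith (fill x) y.
Proof.
apply: functional_extensionality_dep => j.
have [jF|jF] := boolP (j \in F); last first.
  rewrite fillF // dfwith_out ?fillF //.
  by apply: contraNneq jF => <-; exact: valP.
rewrite -[j]/(val (FSetSub jF)) fillT; move: (FSetSub jF) => k.
have [ik|ik] := eqVneq i k; first by case: k / ik; rewrite !dfwith_in.
by rewrite dfwith_out // dfwith_out ?fillT // (inj_eq val_inj).
Qed.

(* The set of all families that agree with [u] outside a finite set. *)
Definition prod_almost : set (forall i, X i) :=
  [set x | finite_set [set i | x i <> u i]]%classic.

Lemma fill_prod_almost (F : {fset I}) (x : forall i : F, X (val i)) :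
  prod_almost (fill x).
Proof.
apply: (@sub_finite_set _ _ [set` F]%classic); last exact: finite_fset.
by move=> i /=; have [//|iF] := boolP (i \in F); rewrite fillF.
Qed.

Variable T : tensor_product X.

(* The span of all elementary tensors of families almost equal to [u], as a
   vector space in its own right (the target of the maps [J^u_F]). *)
Definition tensor_almost : lmodType K :=
  lin_span_space (tensor T @` prod_almost)%classic.

Section FillAll.
Variables (F : {fset I}) (TF : tensor_product (fun i : F => X (val i))).

Definition fill_tensor (x : forall i : F, X (val i)) : tensor_almost :=
  LinSpanSpace (mem_lin_span (imageP (tensor T) (fill_prod_almost x))).

Fact fill_tensor_multilinear : multilinear fill_tensor.
Proof.
move=> x i a y z; apply: val_inj; rewrite linearD linearZ /= !fill_dfwith.
exact: tensor_multilinear.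
Qed.

(* The map [J^u_F], characterized by [tensor_inclE] below. *)
Definition tensor_incl : {linear TF -> tensor_almost} :=
  tensor_lift TF fill_tensor_multilinear.

Lemma tensor_inclE x :
  lin_span_val (tensor_incl (tensor TF x)) = tensor T (fill x).
Proof. by rewrite tensor_liftE. Qed.

End FillAll.

Section FillFinite.
Variables (F G : {fset I}) (TF : tensor_product (fun i : F => X (val i))).
Variable TG : tensor_product (fun i : G => X (val i)).
Hypothesis FG : (F `<=` G)%fset.

Definition fill_finite (x : forall i : F, X (val i)) : TG :=
  tensor TG (fun j : G => fill x (val j)).

Fact fill_finite_multilinear : multilinear fill_finite.
Proof.
move=> x i a y z; rewrite /fill_finite.
have iG : val i \in G by exact: (fsubsetP FG) (valP i).
have restrict (w : X (val i)) : (fun j : G => fill (dfwith x w) (val j)) =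
    @dfwith G (fun j : G => X (val j)) (fun j => fill x (val j)) (FSetSub iG) w.
  apply: functional_extensionality_dep => j; rewrite fill_dfwith.
  have [ij|ij] := eqVneq (FSetSub iG) j.
    by case: j / ij; rewrite [LHS]dfwith_in [RHS]dfwith_in.
  rewrite [RHS]dfwith_out //; apply: dfwith_out.
  by rewrite -(inj_eq val_inj) in ij.
rewrite !restrict; exact: tensor_multilinear.
Qed.

(* The map [J^u_{G;F}], characterized by [tensor_transE] below. *)
Definition tensor_trans : {linear TF -> TG} :=
  tensor_lift TF fill_finite_multilinear.

Lemma tensor_transE x :
  tensor_trans (tensor TF x) = tensor TG (fun j : G => fill x (val j)).
Proof. exact: tensor_liftE. Qed.

End FillFinite.
End Fill.

Record inductive_system (K : fieldType) (D : Type) (le : rel D)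
    (E : D -> lmodType K)
    (phi : forall F G : D, le F G -> {linear E F -> E G}) : Prop := {
  inductive_refl : reflexive le;
  inductive_trans : transitive le;
  inductive_directed : forall F G, exists2 H, le F H & le G H;
  inductive_id : forall F (FF : le F F), phi F F FF =1 id;
  inductive_comp : forall F G H (FG : le F G) (GH : le G H) (FH : le F H),
    phi G H GH \o phi F G FG =1 phi F H FH }.

Definition compatible (K : fieldType) (D : Type) (le : rel D)
    (E : D -> lmodType K) (phi : forall F G : D, le F G -> {linear E F -> E G})
    (W : lmodType K) (h : forall F, {linear E F -> W}) : Prop :=
  forall F G (FG : le F G), h G \o phi F G FG =1 h F.

Definition is_inductive_limit (K : fieldType) (D : Type) (le : rel D)
    (E : D -> lmodType K) (phi : forall F G : D, le F G -> {linear E F -> E G})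
    (L : lmodType K) (j : forall F, {linear E F -> L}) : Prop :=
  [/\ inductive_system phi,
      compatible phi j &
      forall (W : lmodType K) (h : forall F, {linear E F -> W}),
        compatible phi h ->
        exists2 g : {linear L -> W},
          (forall F, g \o j F =1 h F) &
          (forall g' : {linear L -> W},
             (forall F, g' \o j F =1 h F) -> g' =1 g)].

Definition nefset (I : choiceType) := {F : {fset I} | F != fset0}.

Definition nefset_le (I : choiceType) : rel (nefset I) :=
  fun F G => (val F `<=` val G)%fset.

(* Main.v *)
(* The crux is (a).  For each i pick a linear functional phi_i on X_i with
   phi_i(u_i) = 1.  A multilinear map g on the factors indexed by F extends to
   all of I by x |-> (prod_{i notin F} phi_i(x_i)) g(x|F), where the product is
   read as 0 when infinitely many of its factors differ from 1: this convention
   is multilinear because changing one coordinate does not affect finiteness.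
   Taking g = Theta_F gives a left inverse of J^u_F, and F = {}, g = 1 gives a
   functional equal to 1 at Theta_X(u).  For (b), the maps J^u_F are then
   injective, compatible and jointly surjective along a directed system. *)
From HB Require Import structures.
Require Import Defs.
From mathcomp Require Import all_boot all_order all_algebra finmap.
From mathcomp Require Import boolp classical_sets cardinality reals complex.

Set Implicit Arguments.
Unset Strict Implicit.
Unset Printing Implicit Defensive.

Import GRing.Theory.

Local Open Scope ring_scope.

Lemma linear_pack (K : fieldType) (V W : lmodType K) (f : V -> W) :
  linear f -> exists g : {linear V -> W}, g =1 f.
Proof.
move=> fl.
by exists (HB.pack_for {linear V -> W} f (GRing.isLinear.Build K V W _ f fl)).
Qed.

(** * Linear functionals normalised at a non-zero vector *)

Section Functional.
Variables (K : fieldType) (V : lmodType K) (u : V).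
Hypothesis u0 : u != 0.

Let avoiding : set (set V) := [set A |
  (forall a x y, A x -> A y -> A (a *: x + y)) /\ ~ A u]%classic.

(** Zorn's lemma gives a maximal [A] in [avoiding]. If [v] lies outside [A], adjoining the line
    through [v] must capture [u], and solving for [v] expresses it modulo [A] as a multiple of
    [u]. *)
Lemma exists_hyperplane_complement : exists A : set V,
  [/\ (forall a x y, A x -> A y -> A (a *: x + y)), ~ A u &
      forall v, exists c : K, A (v - c *: u)].
Proof.
have chain (F : set (set V)) : (F `<=` avoiding)%classic ->
    total_on F subset -> avoiding (\bigcup_(A in F) A)%classic.
  move=> Fav Ftot; split=> [a x y [A FA Ax] [B FB By]|[A FA]]; last first.
    by case: (Fav _ FA).
  have [AB|BA] := Ftot _ _ FA FB.
    by exists B => //; apply: (Fav _ FB).1 => //; apply: AB.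
  by exists A => //; apply: (Fav _ FA).1 => //; apply: BA.
have [A [[Alin Au] Amax]] := Zorn_bigcup chain.
(* The closure condition admits the empty set, which covers the empty chain, so [0] has to be
   recovered from maximality. *)
have A0 : A 0.
  apply: contrapT => nA0; apply: (Amax (A `|` [set 0])%classic); split.
  - exact: subsetUl.
  - by move=> /(_ 0) A0; apply: nA0; apply: A0; right.
  - move=> a x y [Ax|->] [Ay|->]; rewrite ?scaler0 ?add0r ?addr0.
    + by left; exact: Alin.
    + have [->|a0] := eqVneq a 0; first by rewrite scale0r; right.
      left; have := Alin (a - 1) x x Ax Ax.
      by rewrite scalerBl scale1r subrK.
    + by left.
    + by right.
  - by case=> [//|uE]; move: u0; rewrite uE eqxx.
exists A; split=> // v.
have [Av|nAv] := pselect (A v); first by exists 0; rewrite scale0r subr0.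
(* [B] is closed and strictly larger than [A], since it contains [v]; maximality forces [u] into
   it. *)
pose B := [set w | exists a : K, exists2 m, A m & w = a *: v + m]%classic.
have Bu : B u.
  apply: contrapT => nBu; apply: (Amax B); split.
  - by move=> m Am; exists 0, m => //; rewrite scale0r add0r.
  - by move=> /(_ v) BA; apply/nAv/BA; exists 1, 0 => //; rewrite scale1r addr0.
  - move=> a x y [b [m Am ->]] [c [n An ->]].
    exists (a * b + c), (a *: m + n); first exact: Alin.
    by rewrite scalerDr scalerA scalerDl addrACA.
  - exact: nBu.
have [a [m Am uE]] := Bu.
have a0 : a != 0.
  by apply/eqP => a0; apply: Au; rewrite uE a0 scale0r add0r.
exists a^-1; have -> : v - a^-1 *: u = (- a^-1) *: m + 0.
  by rewrite uE scalerDr scalerA mulVf // scale1r opprD addrA subrr add0r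
             addr0 scaleNr.
exact: Alin.
Qed.

(** The functional sends [v] to its coefficient along [u] modulo [A]. This coefficient is unique,
    because a non-zero multiple of [u] in [A] would put [u] in [A]; linearity and the value at [u]
    follow from uniqueness. *)
Lemma exists_functional : exists phi : {linear V -> K^o}, phi u = 1.
Proof.
have [A [Alin Au /choice[c cA]]] := exists_hyperplane_complement.
have c_uniq v d : A (v - d *: u) -> c v = d.
  move=> dA; apply/eqP; rewrite -subr_eq0; apply/negPn/negP => cd0; apply: Au.
  have A0 : A 0 by have := Alin (-1) _ _ dA dA; rewrite scaleN1r addNr.
  have /(Alin (c v - d)^-1 _ 0)/(_ A0) := Alin (-1) _ _ (cA v) dA.
  rewrite scaleN1r opprB addrA subrK -scalerBl scalerA mulVf // scale1r addr0.
  exact.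
have [|phi phiE] := @linear_pack K V K^o c.
  move=> a x y; apply: (c_uniq _ (a * c x + c y)).
  suff -> : a *: x + y - (a * c x + c y) *: u =
      a *: (x - c x *: u) + (y - c y *: u) by exact: Alin.
  by rewrite scalerDl opprD scalerBr addrACA scalerA.
exists phi; rewrite phiE; apply: c_uniq; rewrite scale1r subrr.
by have := Alin (-1) _ _ (cA u) (cA u); rewrite scaleN1r addNr.
Qed.

End Functional.

Lemma tensor_ext (K : fieldType) (I : eqType) (X : I -> lmodType K)
    (T : tensor_product X) (W : lmodType K) (f g : {linear T -> W}) :
  (forall x, f (tensor T x) = g (tensor T x)) -> f =1 g.
Proof.
move=> fg; have ml : multilinear (fun x => f (tensor T x)).
  by move=> x i a y z; rewrite tensor_multilinear linearP.
have [h _ h_uniq] := tensor_universal T ml.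
by move=> t; rewrite (h_uniq f) // (h_uniq g).
Qed.

(** * Products over an arbitrary index set *)

Section FiniteProduct.
Variables (K : fieldType) (I : choiceType).
Implicit Types c : I -> K.

Definition fprod c : K :=
  if `[< finite_set [set i | c i != 1]%classic >]
  then \prod_(i <- fset_set [set i | c i != 1]%classic) c i else 0.

Lemma fprod_fset c (H : {fset I}) :
  (forall i, c i != 1 -> i \in H) -> fprod c = \prod_(i <- H) c i.
Proof.
move=> cH; have fin : finite_set [set i | c i != 1]%classic.
  by apply: (@sub_finite_set _ _ [set` H]%classic); last exact: finite_fset.
rewrite /fprod asboolT //; apply: big_fset_incl => [|i _].
  by apply/fsubsetP => i; rewrite in_fset_set // => /set_mem /cH.
by rewrite in_fset_set // notin_setE /= => /negP/negPn/eqP.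
Qed.

Lemma fprod1 c : (forall i, c i = 1) -> fprod c = 1.
Proof.
move=> c1; rewrite (@fprod_fset c fset0) ?big_seq_fset0 //.
by move=> i; rewrite c1 eqxx.
Qed.

(** Isolating one factor is what yields linearity in that coordinate. If infinitely many factors
    differ from 1, this remains so after resetting one of them, and both sides are 0. *)
Lemma fprodD1 c i : fprod c = c i * fprod (fun j => if j == i then 1 else c j).
Proof.
set d := fun j => _.
have [cfin|cinf] := pselect (finite_set [set i | c i != 1]%classic).
  (* The index [i] is adjoined because [c i] may be 1; both products are then computed over [H]. *)
  pose H := (i |` fset_set [set i | c i != 1]%classic)%fset.
  have cH j : c j != 1 -> j \in H.
    by move=> cj; rewrite in_fset1U in_fset_set // mem_set ?orbT.
  rewrite (fprod_fset cH) (@fprod_fset d H); last first.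
    by move=> j; rewrite /d; case: ifP => [|_ /cH //]; rewrite eqxx.
  have iH : i \in H by rewrite in_fset1U eqxx.
  rewrite !(big_fsetD1 i iH) /= {1}/d eqxx mul1r; congr (_ * _).
  by apply: eq_big_seq => j; rewrite !inE /d => /andP[/negPf-> _].
have dinf : ~ finite_set [set i | d i != 1]%classic.
  move=> dfin; apply: cinf.
  apply: (@sub_finite_set _ _ ([set i] `|` [set i | d i != 1])%classic).
    move=> j /= cj; have [->|ji] := eqVneq j i; first by left.
    by right; rewrite /d /= (negPf ji).
  by rewrite finite_setU; split=> //; exact: finite_set1.
by rewrite /fprod !asboolF // mulr0.
Qed.

End FiniteProduct.

(** * Extending multilinear maps from finitely many factors to all *)

Section Extension.
Variables (K : fieldType) (I : choiceType) (X : I -> lmodType K).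
Variables (u : forall i, X i) (u_neq0 : forall i, u i != 0).
Variables (F : {fset I}) (W : lmodType K).
Variable g : (forall i : F, X (val i)) -> W.
Hypothesis gml : multilinear g.

Lemma restrict_dfwith_in (x : forall i, X i) (i : F) (y : X (val i)) :
  (fun j : F => dfwith x y (val j)) =
  @dfwith F (fun j : F => X (val j)) (fun j => x (val j)) i y.
Proof.
apply: functional_extensionality_dep => j.
have [ij|ij] := eqVneq i j.
  by case: j / ij; rewrite [LHS]dfwith_in [RHS]dfwith_in.
by rewrite [RHS]dfwith_out //; apply: dfwith_out; rewrite (inj_eq val_inj).
Qed.

Lemma restrict_dfwith_out (x : forall i, X i) (i : I) (y : X i) : i \notin F ->
  (fun j : F => dfwith x y (val j)) = (fun j : F => x (val j)).
Proof.
move=> iF; apply: functional_extensionality_dep => j.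
by apply: dfwith_out; apply: contraNneq iF => ->; exact: valP.
Qed.

Lemma exists_extension (T : tensor_product X) :
  exists L : {linear T -> W}, forall x, L (tensor T (fill u x)) = g x.
Proof.
pose phi i := projT1 (cid (exists_functional (u_neq0 i))).
have phiu i : phi i (u i) = 1 := projT2 (cid (exists_functional (u_neq0 i))).
(* With the factors on [F] set to 1, a coordinate in [F] affects only [g] and any other coordinate
   only the scalar. *)
pose c (x : forall i, X i) i : K := if i \in F then 1 else phi i (x i).
pose f x : W := fprod (c x) *: g (fun i : F => x (val i)).
have fml : multilinear f.
  move=> x k a y z; rewrite /f.
  have [iF|iF] := boolP (k \in F).
    have cE (w : X k) : c (dfwith x w) = c x.
      apply: funext => j; rewrite /c; case: ifP => // jF.
      by rewrite dfwith_out //; apply: contraFneq jF => <-.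
    rewrite !cE -[k]/(val (FSetSub iF)) !restrict_dfwith_in gml.
    by rewrite scalerDr !scalerA mulrC.
  rewrite !restrict_dfwith_out //.
  pose d j := if j == k then 1 else c x j.
  have cE (w : X k) : fprod (c (dfwith x w)) = phi k w * fprod d.
    rewrite (fprodD1 _ k) {1}/c (negPf iF) dfwith_in.
    congr (_ * fprod _); apply: funext => j; rewrite /d.
    have [//|ji] := eqVneq j k; rewrite /c; case: ifP => // _.
    by rewrite dfwith_out // eq_sym.
  by rewrite !cE linearP mulrDl scalerDl !scalerA mulrA.
exists (tensor_lift T fml) => x; rewrite tensor_liftE /f fprod1 => [|i].
  rewrite scale1r; congr (g _).
  by apply: functional_extensionality_dep => i; rewrite fillT.
by rewrite /c; case: ifPn => // iF; rewrite fillF.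
Qed.

End Extension.

Lemma fill_fill (K : fieldType) (I : choiceType) (X : I -> lmodType K)
    (u : forall i, X i) (F G : {fset I}) (x : forall i : F, X (val i)) :
  (F `<=` G)%fset -> fill u (fun j : G => fill u x (val j)) = fill u x.
Proof.
move=> FG; apply: functional_extensionality_dep => j.
have [jG|jG] := boolP (j \in G).
  by rewrite -[j]/(val (FSetSub jG)) fillT.
by rewrite !fillF //; apply: contra jG; exact: (fsubsetP FG).
Qed.

Lemma tensor_incl_inj (K : fieldType) (I : choiceType) (X : I -> lmodType K)
    (u : forall i, X i) (u_neq0 : forall i, u i != 0) (T : tensor_product X)
    (F : {fset I}) (TF : tensor_product (fun i : F => X (val i))) :
  injective (tensor_incl u T TF).
Proof.
have [L LE] := exists_extension u_neq0 (@tensor_multilinear _ _ _ TF) T.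
pose J := tensor_incl u T TF.
apply: (@can_inj _ _ J (fun v => L (lin_span_val v))) => t.
(* Packed as a linear map, the composite can be compared with the identity on elementary tensors
   alone. *)
have [|h hE] := @linear_pack K TF TF (fun t => L (val (J t))).
  by move=> a x y; rewrite !linearP.
rewrite -[LHS]hE -[RHS]/((idfun : {linear TF -> TF}) t).
by apply: tensor_ext => x; rewrite hE [val _]tensor_inclE LE.
Qed.

Lemma tensor_neq0 (K : fieldType) (I : choiceType) (X : I -> lmodType K)
    (u : forall i, X i) (u_neq0 : forall i, u i != 0) (T : tensor_product X) :
  tensor T u != 0.
Proof.
pose g (x : forall i : (fset0 : {fset I}), X (val i)) : K^o := 1.
(* Multilinearity is vacuous, as there is no coordinate to vary. *)
have gml : multilinear g by move=> x [].
have [L LE] := exists_extension u_neq0 gml T.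
have := LE (fun i => u (val i)).
have -> : fill u (fun i : (fset0 : {fset I}) => u (val i)) = u.
  by apply: functional_extensionality_dep => j; rewrite fillF.
by apply: contra_eq_neq => ->; rewrite linear0 eq_sym oner_neq0.
Qed.

(** * A criterion for inductive limits *)

Section InductiveLimit.
Variables (K : fieldType) (D : Type) (le : rel D) (E : D -> lmodType K).
Variable phi : forall F G : D, le F G -> {linear E F -> E G}.
Variables (L : lmodType K) (j : forall F, {linear E F -> L}).
Hypotheses (sys : inductive_system phi) (jcomp : compatible phi j).
Hypothesis j_inj : forall F, injective (j F).
Hypothesis j_surj : forall v, exists F w, j F w = v.

(** The mediating map sends [j F w] to [h F w]. Two representatives of one vector become equal at a
    common upper bound [H], by injectivity of [j H], so the value is well defined; linearity is also
    checked at such an [H]. *)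
Lemma inductive_limit_inj_surj : is_inductive_limit phi j.
Proof.
split=> // W h hcomp.
have h_uniq F G w w' : j F w = j G w' -> h F w = h G w'.
  have [H FH GH] := inductive_directed sys F G.
  rewrite -(jcomp FH) -(jcomp GH) -(hcomp _ _ FH) -(hcomp _ _ GH) /=.
  by move=> /j_inj ->.
have /choice[g0 g0E] v : exists y, forall F w, j F w = v -> h F w = y.
  have [F [w wE]] := j_surj v; exists (h F w) => G w' w'E.
  by apply: h_uniq; rewrite wE.
have [|g gE] := @linear_pack K L W g0.
  move=> a v v'.
  have [F [w wE]] := j_surj v; have [G [w' w'E]] := j_surj v'.
  have [H FH GH] := inductive_directed sys F G.
  rewrite -(g0E _ _ _ wE) -(g0E _ _ _ w'E).
  rewrite -(hcomp _ _ FH) -(hcomp _ _ GH) /= -linearP; apply/esym/g0E.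
  rewrite linearP; have /= -> := jcomp FH w; have /= -> := jcomp GH w'.
  by rewrite wE w'E.
exists g => [F w /=|g' g'E v]; first by rewrite gE (g0E _ F w erefl).
have [F [w <-]] := j_surj v.
by have /= -> := g'E F w; rewrite gE (g0E _ F w erefl).
Qed.

End InductiveLimit.

(** * The system of finite tensor products *)

Section TensorSystem.
Variables (K : fieldType) (I : choiceType) (X : I -> lmodType K).
Variables (u : forall i, X i) (T : tensor_product X).
Variable TF : forall F : nefset I, tensor_product (fun i : val F => X (val i)).

Let trans (F G : nefset I) (FG : nefset_le F G) :=
  tensor_trans u (TF F) (TF G) FG.
Let incl (F : nefset I) := tensor_incl u T (TF F).

Lemma tensor_inductive_system : inductive_system trans.
Proof.
split.
- by move=> F; exact: fsubset_refl.
- by move=> G F H; exact: fsubset_trans.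
- move=> F G.
  have FG0 : (val F `|` val G)%fset != fset0.
    have /fset0Pn[i iF] := valP F.
    by apply/fset0Pn; exists i; rewrite in_fsetU iF.
  by exists (exist (fun F => F != fset0) _ FG0);
    [exact: fsubsetUl | exact: fsubsetUr].
- move=> F FF t; rewrite -[RHS]/((idfun : {linear TF F -> TF F}) t).
  apply: tensor_ext => x; rewrite tensor_transE; congr (tensor _ _).
  by apply: functional_extensionality_dep => i; rewrite fillT.
- move=> F G H FG GH FH; apply: tensor_ext => x /=.
  by rewrite !tensor_transE fill_fill.
Qed.

Lemma tensor_compatible : compatible trans incl.
Proof.
move=> F G FG; apply: tensor_ext => x /=; apply: val_inj.
by rewrite tensor_transE [LHS]tensor_inclE [RHS]tensor_inclE fill_fill.
Qed.

(** A family almost equal to [u] is filled in from the finite set where it differs from [u], and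
    directedness brings the terms of a linear combination to one common stage. The index [i0] keeps
    these finite sets non-empty. *)
Lemma tensor_almost_surj (i0 : I) (v : tensor_almost u T) :
  exists F w, incl F w = v.
Proof.
have ne (F : {fset I}) : (i0 |` F)%fset != fset0.
  by apply/fset0Pn; exists i0; rewrite in_fset1U eqxx.
have elem x : prod_almost u x -> exists F w, val (incl F w) = tensor T x.
  move=> xu; pose G : nefset I :=
    exist (fun F => F != fset0) _ (ne (fset_set [set i | x i <> u i]%classic)).
  exists G, (tensor (TF G) (fun i => x (val i))).
  rewrite [val _]tensor_inclE; congr (tensor _ _).
  apply: functional_extensionality_dep => j.
  have [jG|jG] := boolP (j \in val G).
    by rewrite -[j]/(val (FSetSub jG)) fillT.
  rewrite fillF //; apply: contrapT => /nesym xj; case/negP: jG.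
  by rewrite in_fset1U in_fset_set // mem_set ?orbT.
have sums (s : seq (K * T)) :
    (forall p, p \in s -> (tensor T @` prod_almost u)%classic p.2) ->
    exists F w, val (incl F w) = \sum_(p <- s) p.1 *: p.2.
  elim: s => [_|p s IHs sA].
    by exists (exist (fun F => F != fset0) _ (ne fset0)), 0;
      rewrite linear0 big_nil.
  have [G [w' w'E]] : exists F w, val (incl F w) = \sum_(p <- s) p.1 *: p.2.
    by apply: IHs => q qs; apply: sA; rewrite inE qs orbT.
  have [x xu xE] := sA p (mem_head _ _); have [F [w wE]] := elem x xu.
  have [H FH GH] := inductive_directed tensor_inductive_system F G.
  exists H, (p.1 *: trans FH w + trans GH w'); rewrite big_cons -xE -wE -w'E.
  rewrite !linearP; have /= -> := tensor_compatible FH w.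
  by have /= -> := tensor_compatible GH w'.
case: v => v vA; have /asboolP[s sA vE] := vA.
have [F [w wE]] := sums s sA; exists F, w; apply: val_inj.
by rewrite wE -vE.
Qed.

End TensorSystem.

Theorem proposition2p6 (R : realType) (I : choiceType)
    (I_infinite : infinite_set [set: I]%classic)
    (X : I -> lmodType R[i]) (X_nonzero : forall i, exists x : X i, x != 0)
    (u : forall i, X i) (u_neq0 : forall i, u i != 0)
    (T : tensor_product X)
    (TF : forall F : nefset I, tensor_product (fun i : val F => X (val i))) :
  ((forall F : nefset I, injective (tensor_incl u T (TF F))) /\
   tensor T u != 0) /\
  is_inductive_limit
    (fun (F G : nefset I) (FG : nefset_le F G) =>
       tensor_trans u (TF F) (TF G) FG)
    (fun F : nefset I => tensor_incl u T (TF F)).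
Proof.
have incl_inj (F : nefset I) : injective (tensor_incl u T (TF F)).
  exact: tensor_incl_inj.
split; first by split=> //; exact: tensor_neq0.
have [i0 _] : ([set: I] !=set0)%classic.
  by apply/set0P/eqP => I0; apply: I_infinite; rewrite I0; exact: finite_set0.
apply: inductive_limit_inj_surj => //.
- exact: tensor_inductive_system.
- exact: tensor_compatible.
- exact: (tensor_almost_surj TF i0).
Qed.
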